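(* Let $\triangle(ABC)$ be a (non-degenerate) triangle in the Euclidean plane with edge lengths $a=|BC|$, $b=|AC|$, $c=|AB|$, and let $M$ be its Fermat point, i.e. $A,B,C$ lie (away from $M$) one on each of three rays that start at $M$ and pairwise form an angle of $120^\circ$. Put $a'=|MA|$, $b'=|MB|$, $c'=|MC|$ and $$\Theta^2=\sqrt{(a+b+c)(a+c-b)(b+c-a)(a+b-c)}.$$ Then $$(a')^2=\frac{1}{6}\cdot\frac{\left(\sqrt{3}\,(b^2+c^2-a^2)+\Theta^2\right)^2}{a^2+b^2+c^2+\sqrt{3}\,\Theta^2},$$ $$(b')^2=\frac{1}{6}\cdot\frac{\left(\sqrt{3}\,(a^2+c^2-b^2)+\Theta^2\right)^2}{a^2+b^2+c^2+\sqrt{3}\,\Theta^2},$$ $$(c')^2=\frac{1}{6}\cdot\frac{\left(\sqrt{3}\,(a^2+b^2-c^2)+\Theta^2\right)^2}{a^2+b^2+c^2+\sqrt{3}\,\Theta^2}.$$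
   Context: The Fermat point of a triangle $\triangle(ABC)$ all of whose angles are less than $120^\circ$ is the unique point $M$ in its interior such that $\angle(AMB)=\angle(BMC)=\angle(CMA)=120^\circ$. The symbol $\Theta^2$ denotes the nonnegative square root displayed in the claim (it equals four times the area of the triangle). *)

(* Defs.v *)
From Stdlib Require Export Reals.
Open Scope R_scope.

Definition plane : Type := (R * R)%type.

Definition edist (P Q : plane) : R := dist_euc (fst P) (snd P) (fst Q) (snd Q).

Definition origin : plane := (0, 0).
Definition dot (u v : plane) : R := fst u * fst v + snd u * snd v.
Definition norm (u : plane) : R := edist origin u.

(* Unoriented angle, in [0, PI]; meaningful only for nonzero [u] and [v]. *)
Definition angle (u v : plane) : R := acos (dot u v / (norm u * norm v)).

Definition collinear (P Q S : plane) : Prop :=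
  exists p q r : R, (p <> 0 \/ q <> 0) /\
    forall X : plane, X = P \/ X = Q \/ X = S -> p * fst X + q * snd X = r.

Definition nondegenerate_triangle (A B C : plane) : Prop := ~ collinear A B C.

Definition on_ray (M u P : plane) : Prop :=
  exists t : R, 0 <= t /\ P = (fst M + t * fst u, snd M + t * snd u).

(* The three rays carry the labels of the vertices they contain. Their
   existence already forces every angle of the triangle to be less than
   120 degrees and [M] to be an interior point. *)
Definition fermat_point (A B C M : plane) : Prop :=
  exists u v w : plane,
    (u <> origin /\ v <> origin /\ w <> origin) /\
    (angle u v = 2 * PI / 3 /\ angle v w = 2 * PI / 3 /\
     angle w u = 2 * PI / 3) /\
    (on_ray M u A /\ A <> M) /\
    (on_ray M v B /\ B <> M) /\
    (on_ray M w C /\ C <> M).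

(* The square root that is written as the square of capital theta; by Heron's
   formula it is four times the area of the triangle with sides a, b, c. *)
Definition Theta2 (a b c : R) : R :=
  sqrt ((a + b + c) * (a + c - b) * (b + c - a) * (a + b - c)).

(* Main.v *)
(** With x, y, z the distances from M to A, B, C, the law of cosines at M gives
    a^2 = y^2 + y z + z^2 and its cyclic analogues. Heron's product is then
    3 (x y + y z + z x)^2, so that Theta^2 = sqrt 3 (x y + y z + z x). The
    numerator of the formula for x becomes 12 x^2 (x + y + z)^2 and the
    denominator 2 (x + y + z)^2. *)
Require Import Defs.
From Stdlib Require Import Reals Lra.
Open Scope R_scope.

(** [acos] is total: it is constantly [PI] for [r <= -1] and 0 for [r >= 1]. Neither value is
    [2 * PI / 3], so [r] lies strictly between and [cos] inverts [acos]. *)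
Lemma acos_eq_2PI3 (r : R) : acos r = 2 * PI / 3 -> r = -1 / 2.
Proof.
  intros Hr. pose proof PI_RGT_0 as Hpi.
  destruct (Rle_lt_dec r (-1)) as [Hlo | Hlo].
  { unfold acos in Hr. destruct (Rle_dec r (-1)); lra. }
  destruct (Rle_lt_dec 1 r) as [Hhi | Hhi].
  { unfold acos in Hr. destruct (Rle_dec r (-1)), (Rle_dec 1 r); lra. }
  rewrite <- (cos_acos r) by lra.
  rewrite Hr, <- cos_2PI3. f_equal; field.
Qed.

Lemma edist_sqr (P Q : plane) :
  edist P Q ^ 2 = (fst P - fst Q) ^ 2 + (snd P - snd Q) ^ 2.
Proof.
  unfold edist, dist_euc. rewrite pow2_sqrt by
    (apply Rplus_le_le_0_compat; apply Rle_0_sqr).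
  unfold Rsqr. ring.
Qed.

Lemma edist_ge_0 (P Q : plane) : 0 <= edist P Q.
Proof. apply sqrt_pos. Qed.

Lemma edist_gt_0 (P Q : plane) : Q <> P -> 0 < edist P Q.
Proof.
  intros HQP. destruct (edist_ge_0 P Q) as [Hlt | H0]; [exact Hlt |].
  exfalso. apply HQP. pose proof (edist_sqr P Q) as H.
  rewrite <- H0, pow_i, <- !Rsqr_pow2 in H by auto.
  destruct (Rplus_sqr_eq_0 _ _ (eq_sym H)).
  apply injective_projections; lra.
Qed.

Lemma edist_on_ray (M u : plane) (t : R) :
  0 <= t -> edist M (fst M + t * fst u, snd M + t * snd u) = t * norm u.
Proof.
  intros Ht. unfold norm.
  apply Rsqr_inj; [apply edist_ge_0 | |].
  { apply Rmult_le_pos; [exact Ht | apply edist_ge_0]. }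
  rewrite Rsqr_mult, !Rsqr_pow2, !edist_sqr. simpl. ring.
Qed.

(* Junk value: for a zero vector, [angle u v = acos (0 / 0) = acos 0 = PI / 2]. *)
Lemma dot_angle_2PI3 (u v : plane) :
  angle u v = 2 * PI / 3 -> dot u v = - (norm u * norm v) / 2.
Proof.
  intros H. apply acos_eq_2PI3 in H.
  destruct (Req_dec (norm u * norm v) 0) as [H0 | H0].
  - rewrite H0, Rdiv_0_r in H. lra.
  - replace (dot u v) with (dot u v / (norm u * norm v) * (norm u * norm v))
      by (field; split; intros E; apply H0; rewrite E; ring).
    rewrite H. field.
Qed.

(** With P = M + s u and Q = M + t v, expand |s u - t v|^2; the angle turns the cross term - 2 s t
    (u . v) into + s t |u| |v|. *)
Lemma law_of_cosines_2PI3 (M u v P Q : plane) :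
  angle u v = 2 * PI / 3 -> on_ray M u P -> on_ray M v Q ->
  edist P Q ^ 2 = edist M P ^ 2 + edist M P * edist M Q + edist M Q ^ 2.
Proof.
  intros Huv [s [Hs ->]] [t [Ht ->]].
  apply dot_angle_2PI3 in Huv.
  rewrite !edist_on_ray, edist_sqr by assumption.
  assert (Hu : norm u ^ 2 = fst u ^ 2 + snd u ^ 2)
    by (unfold norm; rewrite edist_sqr; simpl; ring).
  assert (Hv : norm v ^ 2 = fst v ^ 2 + snd v ^ 2)
    by (unfold norm; rewrite edist_sqr; simpl; ring).
  unfold dot in Huv. simpl fst; simpl snd.
  (* This grouping exhibits the dot product and both squared norms literally, ready for
     rewriting. *)
  transitivity (s ^ 2 * (fst u ^ 2 + snd u ^ 2)
                - 2 * s * t * (fst u * fst v + snd u * snd v)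
                + t ^ 2 * (fst v ^ 2 + snd v ^ 2)); [ring |].
  rewrite Huv, <- Hu, <- Hv. field.
Qed.

Lemma Theta2_fermat (a b c x y z : R) :
  0 <= x -> 0 <= y -> 0 <= z ->
  a ^ 2 = y ^ 2 + y * z + z ^ 2 ->
  b ^ 2 = x ^ 2 + x * z + z ^ 2 ->
  c ^ 2 = x ^ 2 + x * y + y ^ 2 ->
  Theta2 a b c = sqrt 3 * (x * y + y * z + z * x).
Proof.
  intros Hx Hy Hz Ha Hb Hc. unfold Theta2.
  (* In this form of Heron's product the sides occur only through their squares, which the
     hypotheses express in [x], [y], [z]. *)
  replace ((a + b + c) * (a + c - b) * (b + c - a) * (a + b - c))
    with (4 * a ^ 2 * b ^ 2 - (a ^ 2 + b ^ 2 - c ^ 2) ^ 2) by ring.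
  rewrite Ha, Hb, Hc.
  replace (4 * _ * _ - _) with (3 * (x * y + y * z + z * x) ^ 2) by ring.
  rewrite sqrt_mult by (try apply pow2_ge_0; lra).
  rewrite sqrt_pow2 by nra. reflexivity.
Qed.

(** The formula for one vertex after substituting the sides and Theta^2; the other two vertices
    follow by permuting the variables. *)
Lemma fermat_distance (x y z : R) :
  0 < x + y + z ->
  x ^ 2 =
  1 / 6 * ((sqrt 3 * ((x ^ 2 + x * z + z ^ 2) + (x ^ 2 + x * y + y ^ 2)
                      - (y ^ 2 + y * z + z ^ 2))
            + sqrt 3 * (x * y + y * z + z * x)) ^ 2
           / ((y ^ 2 + y * z + z ^ 2) + (x ^ 2 + x * z + z ^ 2)
              + (x ^ 2 + x * y + y ^ 2)
              + sqrt 3 * (sqrt 3 * (x * y + y * z + z * x)))).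
Proof.
  intros Hs.
  assert (H3 : sqrt 3 * sqrt 3 = 3) by (apply sqrt_sqrt; lra).
  (* The bracket in the numerator is sqrt 3 * 2 x (x + y + z). Both replacements isolate
     [sqrt 3 * sqrt 3], so that [H3] removes the root. *)
  match goal with |- _ = _ * (?n / ?d) =>
    replace n with (sqrt 3 * sqrt 3 * (2 * x * (x + y + z)) ^ 2) by ring;
    replace d with (2 * (x ^ 2 + y ^ 2 + z ^ 2) + (x * y + y * z + z * x)
                    + sqrt 3 * sqrt 3 * (x * y + y * z + z * x)) by ring
  end.
  rewrite H3.
  replace (2 * _ + _ + _) with (2 * (x + y + z) ^ 2) by ring.
  field. lra.
Qed.

Theorem proposition6 (A B C M : plane)
    (hABC : nondegenerate_triangle A B C) (hM : fermat_point A B C M) :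
  let a := edist B C in
  let b := edist A C in
  let c := edist A B in
  let a' := edist M A in
  let b' := edist M B in
  let c' := edist M C in
  a' ^ 2 = 1 / 6 * ((sqrt 3 * (b ^ 2 + c ^ 2 - a ^ 2) + Theta2 a b c) ^ 2
                    / (a ^ 2 + b ^ 2 + c ^ 2 + sqrt 3 * Theta2 a b c)) /\
  b' ^ 2 = 1 / 6 * ((sqrt 3 * (a ^ 2 + c ^ 2 - b ^ 2) + Theta2 a b c) ^ 2
                    / (a ^ 2 + b ^ 2 + c ^ 2 + sqrt 3 * Theta2 a b c)) /\
  c' ^ 2 = 1 / 6 * ((sqrt 3 * (a ^ 2 + b ^ 2 - c ^ 2) + Theta2 a b c) ^ 2
                    / (a ^ 2 + b ^ 2 + c ^ 2 + sqrt 3 * Theta2 a b c)).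
Proof.
  intros a b c x y z.
  destruct hM as (u & v & w & _ & (Huv & Hvw & Hwu) &
                  (HA & HAM) & (HB & HBM) & (HC & HCM)).
  assert (Hx : 0 < x) by (apply edist_gt_0; exact HAM).
  assert (Hy : 0 < y) by (apply edist_gt_0; exact HBM).
  assert (Hz : 0 < z) by (apply edist_gt_0; exact HCM).
  assert (Ha : a ^ 2 = y ^ 2 + y * z + z ^ 2)
    by exact (law_of_cosines_2PI3 M v w B C Hvw HB HC).
  assert (Hb : b ^ 2 = x ^ 2 + x * z + z ^ 2).
  (* The angle is given from [w] to [u], so this yields |CA|; passing to coordinates identifies it
     with |AC|. *)
  { pose proof (law_of_cosines_2PI3 M w u C A Hwu HC HA) as H.
    unfold b, x, z. rewrite edist_sqr in H |- *. lra. }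
  assert (Hc : c ^ 2 = x ^ 2 + x * y + y ^ 2)
    by exact (law_of_cosines_2PI3 M u v A B Huv HA HB).
  rewrite (Theta2_fermat a b c x y z) by (assumption || lra).
  rewrite Ha, Hb, Hc.
  clearbody x y z. clear - Hx Hy Hz.
  repeat split.
  - apply fermat_distance; lra.
  (* Only the left-hand side is rewritten, as [y ^ 2] also occurs on the right; the two sides then
     differ by a reordering of symmetric terms. *)
  - rewrite (fermat_distance y x z) at 1 by lra.
    do 2 f_equal; [f_equal |]; ring.
  - rewrite (fermat_distance z x y) at 1 by lra.
    do 2 f_equal; [f_equal |]; ring.
Qed.
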